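(* Let $r\ge 3$ and let $(P,\sigma)$ be a signed matroid on $[n]$ whose underlying partition has $m$ parts. Then the enlarged kinematic stratum $$\mathcal{M}^0_{P,\sigma,\le r}\;=\;\bigsqcup_{r'\le r}\mathcal{M}^0_{P,\sigma,r'}$$ is homotopy equivalent to the orbit configuration space $F(\mathbb{S}^{r-2},m)/\mathrm{O}(r-1)$.
   Context: A real symmetric $n\times n$ matrix $S=[s_{ij}]$ of rank $r$ is a Mandelstam matrix if $s_{ii}\ge0$ for all $i$ and $S$ has exactly one positive and exactly $r-1$ negative eigenvalues. $\mathcal{M}^0_{n,r}$ is the set of such matrices of rank $r$ with zero diagonal, a subset of $\mathbb{R}^{\binom n2}$. A (rank two) matroid on $[n]$ is a partition $P=P_1\sqcup\dots\sqcup P_m$ of a subset of $[n]$ into $m\ge2$ non-empty parts; elements of $[n]\setminus P$ are loops; bases are pairs $\{u,v\}$ with $u,v$ in different parts. A signed matroid is $(P,\sigma)$, $\sigma\in\{-,+\}^n$, with $\sigma$ identified with $-\sigma$. The kinematic stratum $\mathcal{M}^0_{P,\sigma,r}$ is the set of $S\in\mathcal{M}^0_{n,r}$ with $\operatorname{sign}(s_{ij})=\sigma_i\sigma_j$ for every basis $\{i,j\}$ and $s_{ij}=0$ for every non-basis pair $i\ne j$. $\mathbb{S}^{r-2}$ is the unit sphere in $\mathbb{R}^{r-1}$, and $F(\mathbb{S}^{r-2},m)=\{(x^{(1)},\dots,x^{(m)})\in(\mathbb{S}^{r-2})^m: x^{(\mu)}\ne x^{(\nu)}\text{ for }\mu\ne\nu\}$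 is the ordered configuration space of $m$ labeled points; the orthogonal group $\mathrm{O}(r-1)$ acts on it diagonally, and $F(\mathbb{S}^{r-2},m)/\mathrm{O}(r-1)$ is the quotient space. *)

(* Defs.v *)
From HB Require Import structures.
From mathcomp Require Export all_boot all_order all_algebra.
From mathcomp Require Export generic_quotient.
From mathcomp Require Export all_classical reals topology.
From mathcomp Require Export normedtype.
Set Implicit Arguments.
Unset Strict Implicit.
Unset Printing Implicit Defensive.
Import Order.TTheory GRing.Theory Num.Theory.
Import numFieldNormedType.Exports.
Local Open Scope classical_set_scope.
Local Open Scope ring_scope.

Section Homotopy.
Variable R : realType.

Definition homotopic (X Y : topologicalType) (f g : X -> Y) : Prop :=
  exists H : X * set_type `[0, 1 : R] -> Y,
    [/\ continuous H,
        forall x t, set_val t = 0 -> H (x, t) = f x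
      & forall x t, set_val t = 1 -> H (x, t) = g x].

Definition homotopy_equivalent (X Y : topologicalType) : Prop :=
  exists (f : X -> Y) (g : Y -> X),
    [/\ continuous f, continuous g,
        homotopic (g \o f) id & homotopic (f \o g) id].

End Homotopy.

Section Mandelstam.
Variables (R : realType) (n : nat).
Implicit Types (S : 'M[R]_n) (r : nat).

(* [s] lists the eigenvalues of [S] with multiplicity; for a real symmetric
   [S] such a list exists and is unique up to permutation. *)
Definition spectrum S (s : seq R) : Prop :=
  char_poly S = \prod_(a <- s) ('X - a%:P).

Definition mandelstam r S : Prop :=
  [/\ S^T = S, \rank S = r, forall i, 0 <= S i i
    & exists s, [/\ spectrum S s, count (fun a => 0 < a) s = 1%N
                  & count (fun a => a < 0) s = r.-1]].

Definition mandelstam0 r : set 'M[R]_n :=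
  [set S | mandelstam r S /\ forall i, S i i = 0].

End Mandelstam.

(* The ground set of the partition is [cover parts]; its complement in ['I_n]
   is the set of loops. *)
Record rank2_matroid (n : nat) := Rank2Matroid {
  parts : {set {set 'I_n}};
  parts_partition : finset.partition parts (finset.cover parts);
  parts_gt1 : (1 < #|parts|)%N }.

Definition is_basis (n : nat) (P : rank2_matroid n) (i j : 'I_n) : bool :=
  [exists A in parts P, exists B in parts P,
     [&& A != B, i \in A & j \in B]].

Section Strata.
Variables (R : realType) (n : nat) (P : rank2_matroid n).
Implicit Type sigma : {ffun 'I_n -> bool}.

(* [sigma i = true] encodes the sign [-], so the sign of [i] is
   [(-1) ^+ sigma i].  A sign vector is a representative of its class modulo
   [sigma ~ - sigma]; see [kinematic_stratumN]. *)
Definition kinematic_stratum sigma (r : nat) : set 'M[R]_n :=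
  [set S | [/\ mandelstam0 r S,
     forall i j, is_basis P i j ->
       Num.sg (S i j) = (-1) ^+ sigma i * (-1) ^+ sigma j
   & forall i j, i != j -> ~~ is_basis P i j -> S i j = 0]].

Definition enlarged_kinematic_stratum sigma (r : nat) : set 'M[R]_n :=
  \bigcup_(r' in [set r' : nat | (r' <= r)%N]) kinematic_stratum sigma r'.

Lemma kinematic_stratumN sigma r :
  kinematic_stratum [ffun i => ~~ sigma i] r = kinematic_stratum sigma r.
Proof.
have E i j : (-1) ^+ (~~ sigma i) * (-1) ^+ (~~ sigma j) =
    (-1) ^+ sigma i * (-1) ^+ sigma j :> R.
  by rewrite !signrN mulrNN.
apply/seteqP; split=> S [hS hb h0]; split=> // i j /hb.
- by rewrite !ffunE E.
- by rewrite !ffunE E.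
Qed.

Lemma trivIset_kinematic_stratum sigma :
  trivIset [set: nat] (kinematic_stratum sigma).
Proof.
move=> r1 r2 _ _ [S [[[[_ r1E _ _] _] _ _] [[[_ r2E _ _] _] _ _]]].
by rewrite -r1E -r2E.
Qed.

End Strata.

Arguments kinematic_stratum R {n} P sigma r.
Arguments enlarged_kinematic_stratum R {n} P sigma r.

(* The sphere of dimension [d - 1] in Euclidean [d]-space. *)
Definition unit_sphere (R : realType) (d : nat) : set 'cV[R]_d :=
  [set x | \sum_(i < d) x i 0 ^+ 2 = 1].
Arguments unit_sphere R d : clear implicits.

Definition configuration (X : topologicalType) (m : nat) :
    set {ptws 'I_m -> X} :=
  [set x | injective x].
Arguments configuration X m : clear implicits.

Definition orthogonal_group (R : realType) (d : nat) : set 'M[R]_d :=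
  [set Q | Q^T *m Q = 1%:M].
Arguments orthogonal_group R d : clear implicits.

Section OrbitConfiguration.
Variables (R : realType) (d m : nat).

Definition sphere_configuration : topologicalType :=
  set_type (configuration (set_type (unit_sphere R d)) m).

Definition same_orbit (x y : sphere_configuration) : bool :=
  `[< exists2 Q, orthogonal_group R d Q &
      forall mu, set_val (set_val y mu) = Q *m set_val (set_val x mu) >].

Lemma same_orbit_refl : reflexive same_orbit.
Proof.
move=> x; apply/asboolP; exists 1%:M; rewrite /orthogonal_group /=.
  by rewrite trmx1 mulmx1.
by move=> mu; rewrite mul1mx.
Qed.

Lemma same_orbit_sym : symmetric same_orbit.
Proof.
suff H x y : same_orbit x y -> same_orbit y x.
  by move=> x y; apply/idP/idP; exact: H.
move=> /asboolP[Q QO xy]; apply/asboolP; exists Q^T.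
  by rewrite /orthogonal_group /= trmxK; exact: mulmx1C.
by move=> mu; rewrite xy mulmxA QO mul1mx.
Qed.

Lemma same_orbit_trans : transitive same_orbit.
Proof.
move=> y x z /asboolP[Q QO xy] /asboolP[Q' QO' yz].
apply/asboolP; exists (Q' *m Q).
  rewrite /orthogonal_group /= trmx_mul -mulmxA (mulmxA Q'^T).
  by rewrite QO' mul1mx.
by move=> mu; rewrite yz xy mulmxA.
Qed.

Definition same_orbit_equiv : equiv_rel sphere_configuration :=
  EquivRel same_orbit same_orbit_refl same_orbit_sym same_orbit_trans.

Definition orbit_configuration : topologicalType :=
  quotient_topology {eq_quot same_orbit_equiv}%qT.

End OrbitConfiguration.

(* Main.v *)
(* A zero-diagonal matrix [S] lies in the enlarged stratum iff, up to the sign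
   pattern, it is the Gram matrix of lightlike vectors [p i = (a i, v i)] in
   Minkowski space R^(1,r-1), vectors in the same part being parallel.  The total
   momentum of one representative per part is timelike; in its rest frame the
   directions of the [p i] form a configuration on the sphere, well defined up
   to O(r-1).  Conversely a configuration [x] gives the lightlike vectors
   [(1, x mu)].  All inner products involved, hence both maps and both
   homotopies (rescaling the momenta; moving the observer along the segment from
   the total momentum to the time axis), are explicit rational functions of
   the entries of [S], resp. of the Gram matrix of [x].  This suffices because
   the orbit space F/O(r-1) embeds in the space of Gram matrices: the Gram map
   is closed on the compact space of all tuples of points of the sphere, and
   its fibres are the O(r-1)-orbits. *)

Require Import Defs.
From mathcomp Require Import derive.
From Stdlib Require Import Ring Field.
Set Implicit Arguments.
Unset Strict Implicit.
Unset Printing Implicit Defensive.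
Import Order.TTheory GRing.Theory Num.Theory.
Import numFieldNormedType.Exports.
Local Open Scope classical_set_scope.
Local Open Scope ring_scope.

(** * Field arithmetic over the reals *)

Section FieldTactic.
Variable R : realType.

(* Copies of the field operations at the fixed carrier [Real.sort R]: the
   reification of [ring] and [field] is syntactic, hence sensitive to the
   structure instances inside the generic operations. *)
Definition fcar : Type := Real.sort R.
Definition fzero : fcar := 0.
Definition fone : fcar := 1.
Definition fadd (x y : fcar) : fcar := x + y.
Definition fmul (x y : fcar) : fcar := x * y.
Definition fopp (x : fcar) : fcar := - x.
Definition finv (x : fcar) : fcar := x^-1.
Definition fsub (x y : fcar) : fcar := x - y.
Definition fdiv (x y : fcar) : fcar := x / y.

Lemma fzeroE : 0 = fzero. Proof. by []. Qed.
Lemma foneE : 1 = fone. Proof. by []. Qed.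
Lemma faddE (x y : R) : x + y = fadd x y. Proof. by []. Qed.
Lemma fmulE (x y : R) : x * y = fmul x y. Proof. by []. Qed.
Lemma foppE (x : R) : - x = fopp x. Proof. by []. Qed.
Lemma finvE (x : R) : x^-1 = finv x. Proof. by []. Qed.

Lemma real_field_theory :
  @field_theory fcar fzero fone fadd fmul fsub fopp fdiv finv eq.
Proof.
split=> //.
- split=> //; [exact: add0r|exact: addrC|exact: addrA|exact: mul1r|exact: mulrC
    |exact: mulrA|exact: mulrDl|exact: subrr].
- by move/eqP; rewrite oner_eq0.
- by move=> p /eqP p0; rewrite /fmul /finv mulVf.
Qed.

End FieldTactic.

Ltac to_field_ops R :=
  rewrite ?expr2 ?mulr2n ?faddE ?fmulE ?foppE ?finvE ?fzeroE ?foneE;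
  match goal with |- @eq _ ?x ?y => change (@eq (fcar R) x y) end.

(** * Continuity of real-valued and matrix-valued maps *)

Section Continuity.
Variables (R : realType) (X : topologicalType).
Implicit Types f g : X -> R.

Lemma continuous_const (y : R) : continuous (fun _ : X => y).
Proof. by move=> x; exact: cst_continuous. Qed.

Lemma continuous_mul f g : continuous f -> continuous g ->
  continuous (fun x => f x * g x).
Proof. by move=> cf cg x; apply: continuousM; [exact: cf|exact: cg]. Qed.

Lemma continuous_add f g : continuous f -> continuous g ->
  continuous (fun x => f x + g x).
Proof. by move=> cf cg x; apply: continuousD; [exact: cf|exact: cg]. Qed.

Lemma continuous_sub f g : continuous f -> continuous g ->
  continuous (fun x => f x - g x).
Proof. by move=> cf cg x; apply: continuousB; [exact: cf|exact: cg]. Qed.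

Lemma continuous_inv f : (forall x, f x != 0) -> continuous f ->
  continuous (fun x => (f x)^-1).
Proof. by move=> f0 cf x; apply: continuousV; [exact: f0|exact: cf]. Qed.

Lemma continuous_norm f : continuous f -> continuous (fun x => `|f x|).
Proof.
move=> cf x; apply: (@continuous_comp _ _ _ f (fun y : R => `|y|)).
  exact: cf.
exact: norm_continuous.
Qed.

Lemma continuous_coord m n (F : X -> 'M[R]_(m, n)) i j :
  continuous F -> continuous (fun x => F x i j).
Proof.
move=> cF x; apply: (@continuous_comp _ _ _ F (fun M : 'M[R]_(m, n) => M i j)).
  exact: cF.
exact: coord_continuous.
Qed.

Lemma continuous_mix (t f g : X -> R) : continuous t -> continuous f ->
  continuous g -> continuous (fun x => (1 - t x) * f x + t x * g x).
Proof.
move=> ct cf cg; apply: continuous_add; apply: continuous_mul => //.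
by apply: continuous_sub => //; exact: continuous_const.
Qed.

Lemma continuous_sum (I : finType) (F : I -> X -> R) :
  (forall i, continuous (F i)) -> continuous (fun x => \sum_i F i x).
Proof.
by move=> cF; apply: continuous_big => //; exact: add_continuous.
Qed.

Lemma continuous_mx m n (F : X -> 'M[R]_(m, n)) :
  (forall i j, continuous (fun x => F x i j)) -> continuous F.
Proof.
move=> cF x A [P PF PA].
have : \forall y \near x, forall ij : 'I_m * 'I_n, P ij.1 ij.2 (F y ij.1 ij.2).
  by apply: filter_forall => -[i j]; exact: (cF i j x _ (PF i j)).
by apply: filterS => y Py; apply: PA => i j; exact: (Py (i, j)).
Qed.

End Continuity.

(** * Euclidean vectors and orthogonal transport *)

Section DotProduct.
Variables (R : realType) (d : nat).
Add Field real_field : (real_field_theory R).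
Implicit Types (u v w x y z : 'cV[R]_d) (Q : 'M[R]_d).

Definition dot u v : R := \sum_i u i 0 * v i 0.

Lemma dotE u v : u^T *m v = (dot u v)%:M.
Proof.
apply/matrixP=> i j; rewrite !ord1 !mxE eqxx mulr1n.
by apply: eq_bigr => k _; rewrite mxE.
Qed.

Lemma dotC u v : dot u v = dot v u.
Proof. by apply: eq_bigr => i _; rewrite mulrC. Qed.

Lemma dotDl u v w : dot (u + v) w = dot u w + dot v w.
Proof. by rewrite -big_split; apply: eq_bigr => i _; rewrite mxE mulrDl. Qed.

Lemma dotZl a u w : dot (a *: u) w = a * dot u w.
Proof. by rewrite mulr_sumr; apply: eq_bigr => i _; rewrite mxE mulrA. Qed.

Lemma dotNl u w : dot (- u) w = - dot u w.
Proof. by rewrite -scaleN1r dotZl mulN1r. Qed.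

Lemma dotDr u v w : dot w (u + v) = dot w u + dot w v.
Proof. by rewrite !(dotC w) dotDl. Qed.

Lemma dotZr a u w : dot w (a *: u) = a * dot w u.
Proof. by rewrite !(dotC w) dotZl. Qed.

Lemma dotNr u w : dot w (- u) = - dot w u.
Proof. by rewrite !(dotC w) dotNl. Qed.

Lemma dot0l w : dot 0 w = 0.
Proof. by rewrite -(scale0r 0) dotZl mul0r. Qed.

Lemma dot_suml (I : finType) (F : I -> 'cV[R]_d) w :
  dot (\sum_i F i) w = \sum_i dot (F i) w.
Proof.
apply: (big_morph (fun u => dot u w)) => [u v|]; [exact: dotDl|exact: dot0l].
Qed.

Definition dot_lin := (dotDl, dotDr, dotZl, dotZr, dotNl, dotNr).

Lemma dot_ge0 u : 0 <= dot u u.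
Proof. by apply: sumr_ge0 => i _; rewrite -expr2 sqr_ge0. Qed.

Lemma dot_eq0 u : (dot u u == 0) = (u == 0).
Proof.
rewrite psumr_eq0 => [|i _]; last by rewrite -expr2 sqr_ge0.
apply/allP/eqP => [h|-> i _]; last by rewrite /= mxE mul0r.
apply/colP => i; rewrite mxE; have := h i; rewrite mem_index_enum => /(_ isT).
by rewrite -expr2 sqrf_eq0 => /eqP.
Qed.

Lemma dot_orthogonal Q x y : Q^T *m Q = 1%:M -> dot (Q *m x) (Q *m y) = dot x y.
Proof.
move=> QQ; have := dotE (Q *m x) (Q *m y).
rewrite trmx_mul mulmxA -(mulmxA x^T) QQ mulmx1 dotE.
by move=> /matrixP/(_ 0 0); rewrite !mxE !mulr1n.
Qed.

(* The reflection in the hyperplane orthogonal to [x - y]. *)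
Lemma orthogonal_exchange x y : dot x x = dot y y ->
  exists Q, [/\ Q^T *m Q = 1%:M, Q *m x = y
    & forall z, dot z x = dot z y -> Q *m z = z].
Proof.
move=> xy; have [->|neq] := eqVneq x y.
  by exists 1%:M; rewrite trmx1 mulmx1; split=> // *; rewrite mul1mx.
pose n := x - y.
have n0 : dot n n != 0 by rewrite dot_eq0 subr_eq0.
pose Q : 'M[R]_d := 1%:M - (2 / dot n n) *: (n *m n^T).
have Qz z : Q *m z = z - (2 * dot n z / dot n n) *: n.
  rewrite mulmxBl mul1mx -scalemxAl -mulmxA dotE mul_mx_scalar scalerA.
  by rewrite mulrAC.
have QT : Q^T = Q.
  by rewrite linearB /= linearZ /= trmx1 trmx_mul trmxK.
have nnE : dot n n = 2 * dot n x.
  rewrite /n !dot_lin (dotC y x) -xy;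
  to_field_ops R; ring.
exists Q; split.
- have Qn : Q *m n = - n.
    by rewrite Qz mulfK // scaler_nat mulr2n opprD addrA subrr sub0r.
  rewrite QT {2}/Q mulmxBr mulmx1 -scalemxAr mulmxA Qn mulNmx scalerN opprK.
  by rewrite /Q subrK.
- by rewrite Qz -nnE divff // scale1r /n opprB addrC subrK.
- move=> z zxy; rewrite Qz /n dotC !dot_lin zxy subrr mulr0 mul0r.
  by rewrite scale0r subr0.
Qed.

(** Induction on the number of vectors already transported. The reflection exchanging [Q *m X ik]
    and [Y ik] fixes every earlier [Y i], since [Y i] has the same product with both. *)
Lemma gram_orthogonal m (X Y : 'I_m -> 'cV[R]_d) :
  (forall i j, dot (X i) (X j) = dot (Y i) (Y j)) ->
  exists2 Q, Q^T *m Q = 1%:M & forall i, Y i = Q *m X i.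
Proof.
move=> XY.
suff H k : (k <= m)%N -> exists2 Q : 'M[R]_d, Q^T *m Q = 1%:M &
    forall i : 'I_m, (i < k)%N -> Y i = Q *m X i.
  by have [Q QQ QX] := H m (leqnn m); exists Q => // i; exact: QX.
elim: k => [|k IHk] lekm; first by exists 1%:M; rewrite ?trmx1 ?mulmx1.
have [Q QQ QX] := IHk (ltnW lekm).
pose ik := Ordinal lekm.
have [|H [HH HX Hfix]] := @orthogonal_exchange (Q *m X ik) (Y ik).
  by rewrite dot_orthogonal.
exists (H *m Q) => [|i].
  by rewrite trmx_mul mulmxA -(mulmxA Q^T) HH mulmx1.
rewrite ltnS leq_eqVlt -mulmxA => /orP[/eqP ik_|/QX Yi].
  by have -> : i = ik by apply/val_inj.
by rewrite Hfix -Yi // {1}Yi dot_orthogonal // XY.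
Qed.

End DotProduct.

(** * Real symmetric matrices *)

Section Spectral.
Variable R : realType.
Add Field real_field : (real_field_theory R).

Lemma continuous_dot (X : topologicalType) d (f g : X -> 'cV[R]_d) :
  continuous f -> continuous g -> continuous (fun x => dot (f x) (g x)).
Proof.
move=> cf cg; apply: continuous_sum => i.
by apply: continuous_mul; exact: continuous_coord.
Qed.

Lemma unit_sphereE d : unit_sphere R d = [set x | dot x x = 1].
Proof.
by apply/seteqP; split=> x /=; rewrite /unit_sphere /dot /= => <-;
  apply: eq_bigr => i _; rewrite expr2.
Qed.

Lemma trmx_continuous d : continuous (fun v : 'rV[R]_d => v^T).
Proof.
apply: continuous_mx => i j x.
have -> : (fun v : 'rV[R]_d => v^T i j) = fun v => v j i.
  by apply/funext => v; rewrite mxE.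
exact: coord_continuous.
Qed.

Lemma mulmx_continuous m d (S : 'M[R]_(m, d)) :
  continuous (fun x : 'cV[R]_d => S *m x).
Proof.
apply: continuous_mx => i j.
have -> : (fun v : 'cV[R]_d => (S *m v) i j) = fun v => dot (row i S)^T v.
  by apply/funext => v; rewrite mxE ord1; apply: eq_bigr => k _; rewrite !mxE.
by apply: continuous_dot => [v|v]; [exact: cst_continuous|exact: id].
Qed.

Lemma unit_sphere_compact d : compact (unit_sphere R d).
Proof.
(* Heine-Borel is applied to row vectors and the result is carried over by transposition. *)
pose A := [set v : 'rV[R]_d | dot v^T v^T = 1].
have -> : unit_sphere R d = trmx @` A.
  rewrite unit_sphereE; apply/seteqP; split=> [x /= xx|_ /= [v vv <-]//].
  by exists x^T; rewrite /A /= ?trmxK.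
apply: continuous_compact.
  by apply: continuous_subspaceT => v; exact: trmx_continuous.
apply: bounded_closed_compact.
  exists 1; split=> // M M1 v /= vv; apply: le_trans (ltW M1).
  rewrite [leLHS]/Num.norm /= mx_normrE; apply/bigmax_leP; split=> // -[i j] _ /=.
  rewrite -(@ler_pXn2r _ 2) ?nnegrE // expr1n -normrX ger0_norm ?sqr_ge0 //.
  rewrite -vv /dot (bigD1 j) //= !mxE -expr2 (ord1 i) lerDl.
  by apply: sumr_ge0 => k _; rewrite -expr2 sqr_ge0.
have -> : A = (fun v : 'rV[R]_d => dot v^T v^T) @^-1` [set x | x = 1] by [].
apply: closed_comp => [v _|]; last exact: closed_eq.
by apply: continuous_dot; exact: trmx_continuous.
Qed.

(** Moving from [v] along [- w] would make the form negative unless [w = 0]. *)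
Lemma psd_dot_eq0 d (B : 'M[R]_d) (v : 'cV[R]_d) : B^T = B ->
  (forall x, 0 <= dot x (B *m x)) -> dot v (B *m v) = 0 -> B *m v = 0.
Proof.
move=> BT B0 vB; set w := B *m v.
have dotB x y : dot x (B *m y) = dot (B *m x) y.
  have := dotE (B *m x) y; rewrite trmx_mul BT -mulmxA dotE.
  by move=> /matrixP/(_ 0 0); rewrite !mxE !mulr1n.
set c := dot w (B *m w); have c0 : 0 <= c by exact: B0.
set b := dot w w.
have c2 : 0 < c + 1 by rewrite ltr_wpDl.
(* The step length has denominator [c + 1] instead of the optimal [c], which may vanish; the form
   still takes the value [- b^2 (c + 2) / (c + 1)^2]. *)
have := B0 (v + (- (b / (c + 1))) *: w).
rewrite mulmxDr -scalemxAr !dot_lin vB -/c (dotB v w) -/w -/b.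
have -> : 0 + - (b / (c + 1)) * b +
    (- (b / (c + 1)) * b + - (b / (c + 1)) * (- (b / (c + 1)) * c)) =
    - (b ^+ 2 * ((c + 1 + 1) / (c + 1) ^+ 2)).
  by to_field_ops R; field; apply/eqP; rewrite gt_eqF.
rewrite oppr_ge0 pmulr_lle0; last first.
  by rewrite divr_gt0 ?exprn_gt0 // ltr_wpDl // ltW.
move=> b0; have : b ^+ 2 == 0 by rewrite eq_le b0 sqr_ge0.
by rewrite sqrf_eq0 dot_eq0 => /eqP.
Qed.

(* A maximiser of the quadratic form on the sphere is an eigenvector. *)
Lemma symmetric_eigenvector n (S : 'M[R]_n.+1) : S^T = S ->
  exists2 v : 'cV[R]_n.+1, dot v v = 1 & exists a, S *m v = a *: v.
Proof.
move=> ST.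
have [||v] := @compact_EVT_max _ R (fun x => dot x (S *m x))
    (unit_sphere R n.+1) _ (@unit_sphere_compact n.+1).
- exists (delta_mx 0 0); rewrite unit_sphereE /= /dot (bigD1 0) //= big1 => [|i].
    by rewrite mxE !eqxx mulr1 addr0.
  by move=> /negbTE i0; rewrite mxE i0 mul0r.
- apply: continuous_subspaceT; apply: continuous_dot => [x|]; first exact: id.
  exact: mulmx_continuous.
rewrite inE unit_sphereE /= => vv vmax.
exists v => //; exists (dot v (S *m v)); set a := dot v (S *m v).
have E x : (a%:M - S) *m x = a *: x - S *m x.
  by rewrite mulmxBl mul_scalar_mx.
(* By maximality, tested on normalised vectors, [a%:M - S] is positive semidefinite, and its form
   vanishes at [v]. *)
apply/eqP; rewrite eq_sym -subr_eq0 -E; apply/eqP; apply: psd_dot_eq0.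
- by rewrite linearB /= tr_scalar_mx ST.
- move=> x; rewrite E !dot_lin subr_ge0.
  have [->|x0] := eqVneq x 0; first by rewrite !dot0l mulr0.
  have xx : 0 < dot x x by rewrite lt_def dot_eq0 x0 dot_ge0.
  have := vmax ((Num.sqrt (dot x x))^-1 *: x).
  rewrite inE /= -scalemxAr !dot_lin !mulrA -!expr2 exprVn sqr_sqrtr ?(ltW xx) //.
  by rewrite mulVf ?gt_eqF // => /(_ erefl); rewrite ler_pdivrMl // mulrC.
- by rewrite E !dot_lin vv mulr1 subrr.
Qed.

(** Deflation: a reflection carries a unit eigenvector to the first basis vector. By symmetry the
    conjugated matrix is then block diagonal, and the induction hypothesis applies to its lower
    block. *)
Lemma symmetric_spectral n (S : 'M[R]_n) : S^T = S ->
  exists (U : 'M[R]_n) (D : 'rV[R]_n),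
    U *m U^T = 1%:M /\ S = U^T *m diag_mx D *m U.
Proof.
elim: n S => [|n IHn] S ST.
  by exists 1%:M, 0; split; apply/matrixP => -[].
have [v vv [a vS]] := symmetric_eigenvector ST.
pose e : 'cV[R]_(1 + n) := col_mx 1%:M 0.
have ee : dot e e = 1.
  rewrite /dot big_split_ord /= big_ord1 [X in _ + X]big1 => [|i _].
    by rewrite /e col_mxEu mxE mulr1 addr0.
  by rewrite /e col_mxEd mxE mul0r.
have [|Q [QQ Qv _]] := @orthogonal_exchange _ _ v e; first by rewrite ee.
have QQ' : Q *m Q^T = 1%:M by exact: mulmx1C.
pose B : 'M[R]_(1 + n) := Q *m S *m Q^T.
have Be : B *m e = a *: e.
  by rewrite -Qv /B -!mulmxA (mulmxA Q^T) QQ mul1mx vS -scalemxAr.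
have BT : B^T = B by rewrite /B !trmx_mul trmxK ST mulmxA.
have Bl : col_mx (ulsubmx B) (dlsubmx B) = col_mx a%:M 0.
  move: Be; rewrite -{1}(submxK B) /e mul_block_col !mulmx1 !mulmx0 !addr0.
  by rewrite scale_col_mx scaler0 scalemx1.
have [Bul Bdl] := eq_col_mx Bl.
have Bur : ursubmx B = 0 by rewrite -BT -trmx_dlsub Bdl trmx0.
have [|U' [D' [UU' BD]]] := IHn (drsubmx B).
  by rewrite trmx_drsub BT.
pose U1 : 'M[R]_(1 + n) := block_mx 1%:M 0 0 U'.
pose D : 'rV[R]_(1 + n) := row_mx a%:M D'.
have BE : B = U1^T *m diag_mx D *m U1.
  rewrite -[LHS]submxK Bul Bdl Bur BD /D diag_mx_row tr_block_mx !trmx0 trmx1.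
  rewrite !mulmx_block !mul0mx !mulmx0 !mul1mx !mulmx1 !addr0 !add0r.
  by rewrite mul0mx; congr block_mx; apply/matrixP => i j;
    rewrite !ord1 !mxE eqxx mulr1n.
have UU1 : U1 *m U1^T = 1%:M.
  rewrite tr_block_mx !trmx0 trmx1 mulmx_block UU' !mul0mx.
  rewrite !mulmx0 !mulmx1 !addr0 !add0r.
  by rewrite -scalar_mx_block.
exists (U1 *m Q), D; split.
  by rewrite trmx_mul -mulmxA (mulmxA Q) QQ' mul1mx.
rewrite trmx_mul !mulmxA -(mulmxA Q^T) -(mulmxA Q^T) -BE /B.
by rewrite -!mulmxA QQ mulmx1 mulmxA QQ mul1mx.
Qed.

Lemma rank_diag_mx n (D : 'rV[R]_n) :
  \rank (diag_mx D) = count (fun a => a != 0) [seq D 0 i | i <- enum 'I_n].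
Proof.
elim: n D => [|n IHn] D.
  by rewrite enum_ord0 /=; apply/eqP; rewrite -leqn0 rank_leq_row.
pose D1 : 'rV[R]_(1 + n) := D.
have := rank_diag_block_mx (diag_mx (lsubmx D1)) (diag_mx (rsubmx D1)).
rewrite -diag_mx_row hsubmxK IHn => rD; rewrite [LHS]rD.
rewrite enum_ordSl /= -map_comp; congr (_ + _)%N.
  rewrite -[diag_mx _](_ : (D 0 0)%:M = _) ?rank_rV.
    rewrite -scalemx1 scaler_eq0.
    by rewrite -[1%:M == 0]mxrank_eq0 mxrank1 orbF.
  apply/matrixP => i j; rewrite !ord1 !mxE eqxx; congr (D _ _ *+ _).
  exact/val_inj.
congr (count _ _); apply: eq_map => i /=; rewrite mxE; congr (D _ _).
exact/val_inj.
Qed.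

(** Links the eigenvalue list of [spectrum] to the diagonal of a spectral decomposition: conjugation
    by [U], lifted to polynomial matrices, preserves the determinant. *)
Lemma orthogonal_diag_char_poly n (U : 'M[R]_n) (D : 'rV[R]_n) :
  U *m U^T = 1%:M ->
  char_poly (U^T *m diag_mx D *m U) =
    \prod_(a <- [seq D 0 i | i <- enum 'I_n]) ('X - a%:P).
Proof.
move=> UU; have UU' : U^T *m U = 1%:M by exact: mulmx1C.
have -> : char_poly (U^T *m diag_mx D *m U) = char_poly (diag_mx D).
  pose P := map_mx polyC U; have PP : P^T *m P = 1%:M.
    by rewrite /P map_trmx -map_mxM UU' map_mx1.
  rewrite /char_poly.
  have -> : char_poly_mx (U^T *m diag_mx D *m U) =
            P^T *m char_poly_mx (diag_mx D) *m P.
    rewrite /char_poly_mx mulmxBr mulmxBl !map_mxM map_trmx; congr (_ - _).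
    by rewrite -[RHS]mulmxA mul_scalar_mx -scalemxAr -map_trmx PP scalemx1.
  by rewrite !det_mulmx mulrC mulrA -det_mulmx (mulmx1C PP) det1 mul1r.
rewrite char_poly_trig ?diag_mx_is_trig // big_map enumT.
by apply: eq_bigr => i _; rewrite !mxE eqxx mulr1n.
Qed.

End Spectral.

(** * Lorentzian Gram matrices *)

Section Lorentz.
Variable R : realType.
Add Field real_field : (real_field_theory R).

(* [S] is the Gram matrix of the vectors [(a i, v i)] for the form of
   signature (1, d). *)
Definition lorentz_gram n d (S : 'M[R]_n) (a : 'I_n -> R)
  (v : 'I_n -> 'cV[R]_d) : Prop := forall i j, S i j = a i * a j - dot (v i) (v j).

Lemma orthogonal_diag_coef n (U : 'M[R]_n) (D : 'rV[R]_n) i j :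
  (U^T *m diag_mx D *m U) i j = \sum_k D 0 k * (U k i * U k j).
Proof.
rewrite mxE; apply: eq_bigr => k _.
by rewrite mul_mx_diag !mxE mulrCA mulrA.
Qed.

Lemma sum_nth_widen (I : eqType) d (e : seq I) (x0 : I) (F : I -> R) :
  (size e <= d)%N ->
  \sum_(l < d) (if (l < size e)%N then F (nth x0 e l) else 0) = \sum_(k <- e) F k.
Proof.
move=> ed; rewrite (big_nth x0) big_mkord.
by rewrite (big_ord_widen d (fun l => F (nth x0 e l)) ed) [RHS]big_mkcond.
Qed.

Lemma mandelstam_lorentz n d r (S : 'M[R]_n) : (r.-1 <= d)%N ->
  mandelstam r S ->
  exists (a : 'I_n -> R) (v : 'I_n -> 'cV[R]_d), lorentz_gram S a v.
Proof.
move=> rd [ST _ _ [s [sS s1 sn]]].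
have [U [D [UU SE]]] := symmetric_spectral ST.
(* Both lists are the roots of the same characteristic polynomial. *)
have pDs : perm_eq s [seq D 0 i | i <- enum 'I_n].
  by apply: prod_XsubC_eq; rewrite -(orthogonal_diag_char_poly D UU) -SE.
pose ep := [seq k <- enum 'I_n | 0 < D 0 k].
pose en := [seq k <- enum 'I_n | D 0 k < 0].
have sep : size ep = 1%N by rewrite -s1 (permP pDs) count_map size_filter.
have sen : (size en <= d)%N.
  by move: rd; rewrite -sn (permP pDs) count_map size_filter.
case Eep: ep sep => [//|k0 [|//]] _.
exists (fun i => Num.sqrt (D 0 k0) * U k0 i),
  (fun i => \col_l if (l < size en)%N then
     let k := nth k0 en l in Num.sqrt (- D 0 k) * U k i else 0).
move=> i j; rewrite SE orthogonal_diag_coef /dot.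
pose F k := D 0 k * (U k i * U k j).
have -> : \sum_k F k = \sum_(k <- ep) F k + \sum_(k <- en) F k.
  rewrite !big_filter !big_enum_cond /= (bigID (fun k => 0 < D 0 k)) /=.
  congr (_ + _); rewrite big_mkcond [RHS]big_mkcond; apply: eq_bigr => k _.
  by rewrite /F; case: ltgtP => //= <-; rewrite mul0r.
rewrite Eep big_seq1; congr (_ + _).
  have k0P : 0 < D 0 k0.
    have : k0 \in ep by rewrite Eep mem_head.
    by rewrite mem_filter => /andP[].
  by rewrite mulrACA -expr2 sqr_sqrtr ?ltW.
rewrite -(sum_nth_widen k0 F sen) -sumrN; apply: eq_bigr => l _.
rewrite !mxE; case: ifP => len /=; last by rewrite mul0r oppr0.
have : nth k0 en l \in en by exact: mem_nth.
rewrite mem_filter => /andP[neg _].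
by rewrite mulrACA -expr2 sqr_sqrtr ?oppr_ge0 ?ltW // mulNr opprK.
Qed.

(** The time part contributes rank at most 1, the space part at most [d]. *)
Lemma lorentz_rank n d (S : 'M[R]_n) a (v : 'I_n -> 'cV[R]_d) :
  lorentz_gram S a v -> (\rank S <= d.+1)%N.
Proof.
move=> Sav; pose A : 'rV[R]_n := \row_i a i.
pose V : 'M[R]_(d, n) := \matrix_(l, i) v i l 0.
have -> : S = A^T *m A + (- V^T) *m V.
  apply/matrixP => i j; rewrite Sav !mxE big_ord1 !mxE; congr (_ + _).
  by rewrite /dot -sumrN; apply: eq_bigr => l _; rewrite !mxE mulNr.
apply: leq_trans (mxrank_add _ _) _; rewrite -[d.+1]add1n; apply: leq_add.
  exact: leq_trans (mxrankM_maxr _ _) (rank_leq_row _).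
exact: leq_trans (mxrankM_maxr _ _) (rank_leq_row _).
Qed.

(* A combination of two eigenvectors with positive eigenvalues orthogonal to
   the time direction would be spacelike and timelike at once. *)
Lemma lorentz_pos_le1 n d (U : 'M[R]_n) (D : 'rV[R]_n)
    a (v : 'I_n -> 'cV[R]_d) k l :
  U *m U^T = 1%:M -> lorentz_gram (U^T *m diag_mx D *m U) a v ->
  0 < D 0 k -> 0 < D 0 l -> k = l.
Proof.
move=> UU Sav Dk Dl; apply/eqP/negPn/negP => kl.
pose al k := \sum_i U k i * a i.
have UUE p q : \sum_i U p i * U q i = (p == q)%:R.
  by have /matrixP/(_ p q) := UU; rewrite !mxE => <-;
    apply: eq_bigr => i _; rewrite mxE.
have key x y : x * al k + y * al l = 0 -> x ^+ 2 * D 0 k + y ^+ 2 * D 0 l <= 0.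
  move=> xy0; pose w i := x * U k i + y * U l i.
  have wa : \sum_i w i * a i = 0.
    rewrite -[RHS]xy0 /al !mulr_sumr -big_split; apply: eq_bigr => i _ /=.
    by rewrite mulrDl !mulrA.
  have wU p : \sum_i U p i * w i = x * (p == k)%:R + y * (p == l)%:R.
    rewrite -!UUE !mulr_sumr -big_split; apply: eq_bigr => i _ /=.
    by rewrite mulrDr !(mulrCA (U p i)).
  (* The quadratic form at [w] is computed in the eigenbasis here, and from the Lorentzian
     realisation afterwards; there the time part vanishes and minus a squared norm remains. *)
  have <- : \sum_i \sum_j w i * w j * (U^T *m diag_mx D *m U) i j =
      x ^+ 2 * D 0 k + y ^+ 2 * D 0 l.
    transitivity (\sum_p D 0 p * (\sum_i U p i * w i) ^+ 2).
      under [RHS]eq_bigr => p _ do rewrite expr2 mulr_suml mulr_sumr.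
      rewrite [RHS]exchange_big; apply: eq_bigr => i _ /=.
      under [RHS]eq_bigr => p _ do rewrite mulrA mulr_sumr.
      rewrite [RHS]exchange_big; apply: eq_bigr => j _ /=.
      rewrite orthogonal_diag_coef mulr_sumr; apply: eq_bigr => p _.
      by rewrite mulrC -!mulrA; do 2!congr (_ * _); rewrite mulrCA.
    rewrite (bigD1 k) //= [X in _ + X = _](bigD1 l) /=; last by rewrite eq_sym.
    rewrite [X in _ + (_ + X)]big1 => [|p /andP[pk pl]].
      rewrite !wU !eqxx (negbTE kl) eq_sym (negbTE kl).
      by rewrite !mulr1 !mulr0 !addr0 add0r mulrC (mulrC (D 0 l)).
    by rewrite wU (negbTE pk) (negbTE pl) !mulr0 addr0 expr0n mulr0.
  have -> : \sum_i \sum_j w i * w j * (U^T *m diag_mx D *m U) i j =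
      (\sum_i w i * a i) ^+ 2 - dot (\sum_i w i *: v i) (\sum_j w j *: v j).
    rewrite dot_suml expr2 mulr_suml -sumrB; apply: eq_bigr => i _.
    rewrite dotC dot_suml mulr_sumr -sumrB; apply: eq_bigr => j _.
    rewrite Sav !dot_lin (dotC (v j)); to_field_ops R; ring.
  by rewrite wa expr0n sub0r oppr_le0 dot_ge0.
(* The weights [(1, 0)], resp. [(- al l, al k)], cancel the time component and make the left side of
   [key] positive. *)
have [ak0|ak0] := eqVneq (al k) 0.
  have := key 1 0; rewrite ak0 mulr0 mul0r addr0 => /(_ erefl).
  by rewrite expr1n mul1r expr0n mul0r addr0 leNgt Dk.
have := key (- al l) (al k).
rewrite mulNr mulrC addNr => /(_ erefl); apply/negP; rewrite -ltNge sqrrN.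
apply: ltr_wpDl; first by rewrite mulr_ge0 ?sqr_ge0 ?(ltW Dk).
by rewrite mulr_gt0 // exprn_even_gt0.
Qed.

Lemma count_neq0 (s : seq R) : count (fun x => x != 0) s =
  (count (fun x => (0 < x)%R) s + count (fun x => (x < 0)%R) s)%N.
Proof.
by elim: s => //= x s ->; case: ltgtP => _;
  rewrite /= ?add0n ?add1n ?addnS ?addSn.
Qed.

(** At most one eigenvalue is positive by [lorentz_pos_le1]. If none were, the zero trace would
    force all of them to vanish, against [S != 0]. The rank counts the nonzero eigenvalues and so
    fixes the number of negative ones. *)
Lemma lorentz_mandelstam0 n d (S : 'M[R]_n) a (v : 'I_n -> 'cV[R]_d) :
  lorentz_gram S a v -> (forall i, S i i = 0) -> S != 0 ->
  exists2 r, (r <= d.+1)%N & mandelstam0 r S.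
Proof.
move=> Sav S0 Sn0.
have ST : S^T = S by apply/matrixP => i j; rewrite mxE !Sav mulrC dotC.
have [U [D [UU SE]]] := symmetric_spectral ST.
exists (\rank S); first exact: lorentz_rank Sav.
split=> //; split=> // [i|]; first by rewrite S0.
have Uu : U \in unitmx by have [] := mulmx1_unit UU.
have rS : \rank S = \rank (diag_mx D).
  rewrite SE mxrankMfree ?row_free_unit //.
  by rewrite eqmxMfull // row_full_unit unitmx_tr.
have pos1 : count (fun x => 0 < x) [seq D 0 i | i <- enum 'I_n] = 1%N.
  rewrite count_map -size_filter; set e := (X in size X).
  have ue : uniq e by rewrite filter_uniq // enum_uniq.
  have eD k : k \in e -> 0 < D 0 k by rewrite mem_filter => /andP[].
  case E : e ue eD => [|k [|l e']] //; last first.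
    move=> /= /andP[+ _] eD; rewrite inE negb_or => /andP[/eqP kl _].
    case: kl; apply: (lorentz_pos_le1 UU (D := D) (a := a) (v := v)).
    - by rewrite -SE.
    - by apply: eD; rewrite mem_head.
    - by apply: eD; rewrite !inE eqxx orbT.
  move=> _ _; case/eqP: Sn0.
  have D0 k : D 0 k <= 0.
    rewrite leNgt; apply/negP => Dk.
    have : k \in e by rewrite mem_filter mem_enum /= Dk.
    by rewrite E.
  have trD : \sum_k - D 0 k = 0.
    have : \tr S = 0 by rewrite /mxtrace big1.
    rewrite SE -mulmxA mxtrace_mulC -mulmxA UU mulmx1 mxtrace_diag => tr0.
    by rewrite sumrN tr0 oppr0.
  rewrite SE; apply/matrixP => i j; rewrite orthogonal_diag_coef mxE big1 // => k _.
  have /eqP := trD; rewrite psumr_eq0 => [|l _]; last by rewrite oppr_ge0.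
  move=> /allP/(_ k); rewrite mem_index_enum => /(_ isT).
  by rewrite oppr_eq0 => /eqP ->; rewrite mul0r.
exists [seq D 0 i | i <- enum 'I_n]; split=> //.
- by rewrite /spectrum {1}SE; exact: orthogonal_diag_char_poly.
- by rewrite rS rank_diag_mx count_neq0 pos1.
Qed.

End Lorentz.

(** * Lightlike vectors and Lorentz boosts *)

Section Boost.
Variables (R : realType) (d : nat).
Add Field real_field : (real_field_theory R).
Implicit Types (v w : 'cV[R]_d).

(** Equality case of Cauchy-Schwarz: the squared norm of the difference expands to 0. *)
Lemma lightlike_parallel (a a' : R) v v' :
  a ^+ 2 = dot v v -> a' ^+ 2 = dot v' v' -> a * a' = dot v v' ->
  a *: v' = a' *: v.
Proof.
move=> av av' avv; apply/eqP; rewrite -subr_eq0 -dot_eq0 !dot_lin.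
rewrite (dotC v' v) -av -av' -avv; apply/eqP; to_field_ops R; ring.
Qed.

(** The right-hand side is minus the Minkowski form on the orthogonal complement of [(u, w)], read
    in the space coordinates. It is positive definite for timelike [(u, w)], and [L] is its
    symmetric square root. *)
Lemma boost_isometry (u : R) w (q := u ^+ 2 - dot w w) : 0 < q ->
  exists L : 'M[R]_d, forall v v', dot (L *m v) (L *m v') =
    dot v v' - dot w v * dot w v' / u ^+ 2.
Proof.
move=> q0; pose s := Num.sqrt q; pose t := `|u|.
have s0 : 0 < s by rewrite sqrtr_gt0.
have tt : t ^+ 2 = u ^+ 2 by rewrite -normrX ger0_norm ?sqr_ge0.
have ss : s ^+ 2 = q by rewrite sqr_sqrtr // ltW.
have t0 : 0 < t.
  rewrite normr_gt0; apply/eqP => u0.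
  by move: q0; rewrite /q u0 expr0n sub0r oppr_gt0 ltNge dot_ge0.
have ww : dot w w = t ^+ 2 - s ^+ 2 by rewrite tt ss /q opprB addrC subrK.
(* With this [c] the eigenvalue of [L] along [w] is [s / t], whose square is [1 - dot w w / t^2].
   Taking [t] as the absolute value of [u] keeps [t + s] positive. *)
pose c := (t * (t + s))^-1.
exists (1%:M - c *: (w *m w^T)) => v v'.
have E x : (1%:M - c *: (w *m w^T)) *m x = x - (c * dot w x) *: w.
  by rewrite mulmxBl mul1mx -scalemxAl -mulmxA dotE mul_mx_scalar scalerA.
rewrite !E !dot_lin ww -tt (dotC v w) /c.
to_field_ops R; field.
have P : fadd t s <> fzero R by apply/eqP; rewrite gt_eqF // addr_gt0.
have T : t <> fzero R by apply/eqP; rewrite gt_eqF.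
by do ?split.
Qed.

(* Lightlike vectors [(a i, v i)] as seen by an observer with timelike
   velocity [(u, w)]: the [x i] are their directions. *)
Lemma boost_directions (I : Type) (a : I -> R) (v : I -> 'cV[R]_d) (u : R) w
    (q := u ^+ 2 - dot w w) (b := fun i => u * a i - dot w (v i)) :
  0 < q -> (forall i, b i != 0) ->
  exists x : I -> 'cV[R]_d, forall i j,
    dot (x i) (x j) = 1 - (a i * a j - dot (v i) (v j)) * q / (b i * b j).
Proof.
move=> q0 b0; have [L LE] := boost_isometry q0.
pose s := Num.sqrt q.
have s0 : 0 < s by rewrite sqrtr_gt0.
have ss : q = s ^+ 2 by rewrite sqr_sqrtr // ltW.
have ww : dot w w = u ^+ 2 - s ^+ 2 by rewrite -ss /q opprB addrC subrK.
have u0 : u != 0.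
  apply/eqP => u0.
  by move: q0; rewrite /q u0 expr0n sub0r oppr_gt0 ltNge dot_ge0.
(* Scaled by [s / b i], the [i]-th vector minus [(u, w) / s] is Minkowski-orthogonal to [(u, w)];
   [L] turns its space part into a Euclidean vector. *)
exists (fun i => L *m ((s / b i) *: v i - s^-1 *: w)) => i j.
rewrite LE !dot_lin ww (dotC (v i) w) ss.
have := b0 j; have := b0 i; rewrite /b.
set A := a i; set B := a j; set X := dot w (v i); set Y := dot w (v j).
set Z := dot (v i) (v j) => /eqP bi /eqP bj.
to_field_ops R; field.
by split; [|split; [|split]] => //; apply/eqP => //; rewrite gt_eqF.
Qed.

End Boost.

(** * The orbit space and Gram matrices *)

Lemma unit_sphereP (R : realType) d (x : 'cV[R]_d) :
  unit_sphere R d x -> dot x x = 1.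
Proof. by rewrite unit_sphereE. Qed.

(** A filter on the subtype is pushed forward to the ambient space, where it has a cluster point in
    [A]. *)
Lemma compact_set_type (X : topologicalType) (A : set X) :
  compact A -> compact [set: set_type A].
Proof.
move=> cA F FF _.
have [|p [Ap clp]] := cA (set_val @ F) _.
  have : F (set_val @^-1` A) by apply: filterE => x; exact: (set_valP x).
  by [].
exists (exist _ p (mem_set Ap)); split=> // B C FB [_ [[C' oC' <-] /= C'p C'C]].
have [|_ [[b Bb <-] C'b]] := clp (set_val @` B) C' _ (open_nbhs_nbhs (conj oC' C'p)).
  have : F (set_val @^-1` (set_val @` B)) by apply: filterS FB => b Bb; exists b.
  by [].
by exists b; split=> //; exact: C'C.
Qed.

Section OrbitGram.
Variables (R : realType) (d m : nat).
Add Field real_field : (real_field_theory R).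
Local Notation conf := (sphere_configuration R d m).
Local Notation orb := (orbit_configuration R d m).
Implicit Types (c : conf) (mu nu : 'I_m).

Local Notation tuples := {ptws 'I_m -> set_type (unit_sphere R d)}.

(** Defined on all tuples, coincident points included, because that space is compact whereas the
    configuration space need not be. *)
Definition tuple_gram (y : tuples) : 'M[R]_m :=
  \matrix_(mu, nu) dot (set_val (y mu)) (set_val (y nu)).

Definition conf_point c mu : 'cV[R]_d := set_val (set_val c mu).

Definition gram c : 'M[R]_m := tuple_gram (set_val c).

Lemma tuples_compact : compact [set: tuples].
Proof.
have := @tychonoff 'I_m (fun=> set_type (unit_sphere R d)) (fun=> setT)
  (fun=> compact_set_type (@unit_sphere_compact R d)).
by congr compact; apply/seteqP; split.
Qed.

Lemma tuple_gram_continuous : continuous tuple_gram.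
Proof.
have cp mu : continuous (fun y : tuples => set_val (y mu) : 'cV[R]_d).
  move=> y; apply: (@continuous_comp _ _ _ (fun z : tuples => z mu) set_val).
    exact: proj_continuous.
  exact: initial_continuous.
apply: continuous_mx => mu nu.
have -> : (fun y : tuples => tuple_gram y mu nu) =
    fun y => dot (set_val (y mu)) (set_val (y nu)).
  by apply/funext => y; rewrite mxE.
by apply: continuous_dot; exact: cp.
Qed.

Lemma dot_conf_point c mu : dot (conf_point c mu) (conf_point c mu) = 1.
Proof. by apply: unit_sphereP; exact: set_valP. Qed.

Lemma conf_point_inj c : injective (conf_point c).
Proof.
move=> mu nu /val_inj; exact: (set_valP c).
Qed.

Lemma gramE c mu nu : gram c mu nu = dot (conf_point c mu) (conf_point c nu).
Proof. by rewrite mxE. Qed.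

Lemma gram_diag c mu : gram c mu mu = 1.
Proof. by rewrite gramE dot_conf_point. Qed.

Lemma gram_offdiag c mu nu : mu != nu -> gram c mu nu < 1.
Proof.
move=> munu; rewrite gramE; set x := conf_point c mu; set y := conf_point c nu.
(* For unit vectors the squared distance is [2 (1 - dot x y)]. *)
have : 0 < dot (x - y) (x - y).
  rewrite lt_def dot_ge0 dot_eq0 subr_eq0 andbT.
  by apply: contra munu => /eqP/conf_point_inj/eqP.
have -> : dot (x - y) (x - y) = (1 - dot x y) *+ 2.
  by rewrite !dot_lin !dot_conf_point (dotC y x); to_field_ops R; ring.
by rewrite pmulrn_lgt0 // subr_gt0.
Qed.

Lemma conf_of_points (x : 'I_m -> 'cV[R]_d) :
  (forall mu, dot (x mu) (x mu) = 1) ->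
  (forall mu nu, mu != nu -> dot (x mu) (x nu) != 1) ->
  exists c, forall mu, conf_point c mu = x mu.
Proof.
move=> x1 xN1.
have xS mu : x mu \in unit_sphere R d by rewrite unit_sphereE inE.
pose y : {ptws 'I_m -> set_type (unit_sphere R d)} :=
  fun mu => exist _ (x mu) (xS mu).
have yc : y \in configuration (set_type (unit_sphere R d)) m.
  rewrite inE => mu nu /(congr1 val) /= xx; apply/eqP/negPn/negP => /xN1.
  by rewrite xx x1 eqxx.
by exists (exist _ y yc).
Qed.

Lemma gram_continuous : continuous gram.
Proof.
move=> c; apply: (@continuous_comp _ _ _ set_val tuple_gram).
  exact: initial_continuous.
exact: tuple_gram_continuous.
Qed.

(** The Gram matrix is a complete invariant of the orbits, by [gram_orthogonal]. *)
Lemma same_orbitP c c' : reflect (gram c = gram c') (same_orbit c c').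
Proof.
apply: (iffP (asboolP _)) => [[Q QO E]|E].
  apply/matrixP => mu nu; rewrite !mxE /conf_point !E dot_orthogonal //.
have [|Q QO QE] := @gram_orthogonal R d m (conf_point c) (conf_point c').
  by move=> mu nu; have /matrixP/(_ mu nu) := E; rewrite !mxE.
by exists Q.
Qed.

Definition orbit_of c : orb := (\pi_(orb) c)%qT.

Definition orbit_gram (z : orb) : 'M[R]_m := gram (repr z).

Lemma orbit_of_eq c c' : orbit_of c = orbit_of c' <-> gram c = gram c'.
Proof.
rewrite /orbit_of; split.
  by move=> /eqmodP /= /same_orbitP.
by move=> E; apply/eqmodP; apply/same_orbitP.
Qed.

Lemma orbit_gramE c : orbit_gram (orbit_of c) = gram c.
Proof. by apply/orbit_of_eq; rewrite /orbit_of reprK. Qed.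

Lemma orbit_gram_inj : injective orbit_gram.
Proof.
move=> z z' /orbit_of_eq; rewrite /orbit_of !reprK //.
Qed.

Lemma orbit_gram_continuous : continuous orbit_gram.
Proof.
apply/quotient_continuous => c.
have -> : orbit_gram \o \pi_orb%qT = gram by apply/funext => x; exact: orbit_gramE.
exact: gram_continuous.
Qed.

(* A discontinuous lift [h] still induces a continuous map to the orbit space
   because the Gram map is closed on the compact space of all [m]-tuples of
   points of the sphere. *)
Lemma orbit_of_continuous (Z : topologicalType) (h : Z -> conf) :
  continuous (gram \o h) -> continuous (orbit_of \o h).
Proof.
move=> ch; apply/continuousP => O oO.
(* The topologies are unfolded: the preimage of [O] among configurations is the trace of an open set
   [W] of tuples. *)
have [W oW WE] : open (orbit_of @^-1` O) by [].
have clG : closed (tuple_gram @` (~` W)).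
  apply: compact_closed; first exact: norm_hausdorff.
  apply: continuous_compact.
    by apply: continuous_subspaceT; exact: tuple_gram_continuous.
  apply: subclosed_compact tuples_compact _ => //.
  exact: open_closedC.
(* A tuple with the Gram matrix of a configuration has distinct points and lies in the same orbit.
   Hence [h z] lands in [O] exactly when its Gram matrix avoids the closed image of the complement
   of [W]. *)
have -> : (orbit_of \o h) @^-1` O = (gram \o h) @^-1` (~` (tuple_gram @` (~` W))).
  apply/seteqP; split=> z /=.
    move=> Oz [y Wy Gy]; apply: Wy.
    have yc : y \in configuration (set_type (unit_sphere R d)) m.
      rewrite inE => mu nu yy; apply/eqP/negPn/negP => /(gram_offdiag (h z)).
      rewrite -Gy mxE yy.
      by rewrite (unit_sphereP (set_valP (y nu))) ltxx.
    pose c : conf := exist _ y yc.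
    have : (orbit_of @^-1` O) c.
      rewrite /= (_ : orbit_of c = orbit_of (h z)) //; apply/orbit_of_eq.
      by rewrite -Gy.
    by rewrite -WE.
  move=> nG; have : (set_val @^-1` W) (h z); last by rewrite WE.
  by apply: contrapT => nW; apply: nG; exists (set_val (h z)).
by move/continuousP: ch; apply; exact: closed_openC.
Qed.

(** Continuous maps into the orbit space are given below by formulas for Gram matrices; the lifts to
    configurations are merely chosen pointwise. *)
Lemma orbit_realize (Z : topologicalType) (F : Z -> 'M[R]_m) :
  continuous F -> (forall z, exists c, gram c = F z) ->
  exists2 f : Z -> orb, continuous f & forall z, orbit_gram (f z) = F z.
Proof.
move=> cF /choice[h hF]; exists (orbit_of \o h).
  by apply: orbit_of_continuous; have -> : gram \o h = F by exact/funext.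
by move=> z; rewrite orbit_gramE.
Qed.

End OrbitGram.

(** * The stratum as a space of lightlike momenta *)

(** Replaces the partition by labels: [idx] sends an element to its part and a loop to [None], and
    [rep] picks one element of each part. *)
Lemma matroid_index n (P : rank2_matroid n) :
  exists (idx : 'I_n -> option 'I_#|parts P|) (rep : 'I_#|parts P| -> 'I_n),
    (forall mu, idx (rep mu) = Some mu) /\
    forall i j, is_basis P i j =
      if (idx i, idx j) is (Some mu, Some nu) then mu != nu else false.
Proof.
have /and3P[_ /finset.trivIsetP tI n0] := parts_partition P.
have [rep repP] : exists rep : 'I_#|parts P| -> 'I_n,
    forall mu, rep mu \in enum_val mu.
  have /choice[rep repP] : forall mu : 'I_#|parts P|, exists i, i \in enum_val mu.
    move=> mu; apply/finset.set0Pn; apply: contraNneq n0 => <-; exact: enum_valP.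
  by exists rep.
pose idx i := [pick mu : 'I_#|parts P| | i \in enum_val mu].
have uniq_idx i (mu nu : 'I_#|parts P|) :
    i \in enum_val mu -> i \in enum_val nu -> mu = nu.
  move=> imu inu; apply/enum_val_inj/eqP/negPn/negP => munu.
  have /pred0P/(_ i) := tI _ _ (enum_valP mu) (enum_valP nu) munu.
  by rewrite /= imu inu.
have idxP i (mu : 'I_#|parts P|) : (idx i == Some mu) = (i \in enum_val mu).
  rewrite /idx; case: pickP => [nu inu|/(_ mu) -> //].
  by apply/eqP/idP => [[<-]//|imu]; rewrite (uniq_idx _ _ _ inu imu).
exists idx, rep; split=> [mu|i j]; first by apply/eqP; rewrite idxP.
apply/existsP/idP.
  case=> A /andP[PA /existsP[B /andP[PB /and3P[AB iA jB]]]].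
  have /eqP -> : idx i == Some (enum_rank_in PA A) by rewrite idxP enum_rankK_in.
  have /eqP -> : idx j == Some (enum_rank_in PA B) by rewrite idxP enum_rankK_in.
  apply: contra AB => /eqP/(congr1 enum_val).
  by rewrite !enum_rankK_in // => ->.
case Ei: (idx i) => [mu|//]; case Ej: (idx j) => [nu|//] munu.
move/eqP: Ei; rewrite idxP => imu; move/eqP: Ej; rewrite idxP => jnu.
exists (enum_val mu); rewrite enum_valP /=; apply/existsP; exists (enum_val nu).
by rewrite enum_valP /= imu jnu !andbT (inj_eq enum_val_inj).
Qed.

Section Stratum.
Variables (R : realType) (n m d : nat).
Variables (idx : 'I_n -> option 'I_m) (rep : 'I_m -> 'I_n).
Variable sigma : {ffun 'I_n -> bool}.
Hypothesis idx_rep : forall mu, idx (rep mu) = Some mu.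
Hypothesis m_gt1 : (1 < m)%N.
Add Field real_field : (real_field_theory R).
Implicit Types (S : 'M[R]_n) (G : 'M[R]_m).

Definition split_pair i j : bool :=
  if (idx i, idx j) is (Some mu, Some nu) then mu != nu else false.

Definition sgn i : R := (-1) ^+ sigma i.

(** Rank and signature are traded for a Minkowski realisation; see [enlarged_stratumE]. The second
    condition includes the diagonal, by [split_pairxx]. *)
Definition lorentz_stratum : set 'M[R]_n :=
  [set S : 'M[R]_n | [/\ forall i j, split_pair i j -> Num.sg (S i j) = sgn i * sgn j,
     forall i j, ~~ split_pair i j -> S i j = 0
   & exists (a : 'I_n -> R) (v : 'I_n -> 'cV[R]_d), lorentz_gram S a v]].

Lemma sgn2 i : sgn i * sgn i = 1.
Proof. by rewrite -expr2 sqrr_sign. Qed.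

Lemma normr_sgn i : `|sgn i| = 1.
Proof. by rewrite normrX normrN1 expr1n. Qed.

Lemma sgr_sgn i : Num.sg (sgn i) = sgn i.
Proof.
by rewrite /sgn; case: (sigma i); rewrite ?expr1 ?sgrN1 ?expr0 ?sgr1.
Qed.

Lemma other_index (mu : 'I_m) : exists nu, mu != nu.
Proof.
have m0 := ltnW m_gt1.
have [->|mu0] := eqVneq mu (Ordinal m0); last by exists (Ordinal m0).
by exists (Ordinal m_gt1).
Qed.

Lemma split_pairxx i : ~~ split_pair i i.
Proof. by rewrite /split_pair; case: (idx i) => // mu; rewrite eqxx. Qed.

Lemma lorentz_stratum_neq0 S : lorentz_stratum S -> S != 0.
Proof.
case=> sgS _ _; have [nu munu] := other_index (Ordinal m_gt1).
apply/eqP => S0; have := sgS (rep (Ordinal m_gt1)) (rep nu).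
rewrite /split_pair !idx_rep munu S0 mxE sgr0 => /(_ isT)/(congr1 Num.norm).
by rewrite normrM !normr_sgn normr0 mulr1 => /esym/eqP; rewrite oner_eq0.
Qed.

(** Multiplying momentum [i] by [sgn i] makes all products nonnegative, so absolute values of
    entries are the Gram matrix of the normalised momenta. *)
Lemma normr_stratum S i j : lorentz_stratum S -> `|S i j| = sgn i * sgn j * S i j.
Proof.
case=> sgS S0 _; have [ij|ij] := boolP (split_pair i j).
  by rewrite -sgS // -normrEsg.
by rewrite S0 // normr0 mulr0.
Qed.

Lemma stratumE S i j : lorentz_stratum S -> S i j = sgn i * sgn j * `|S i j|.
Proof.
by move=> SS; rewrite normr_stratum // mulrA mulrACA !sgn2 !mul1r.
Qed.

Lemma stratum_sym S i j : lorentz_stratum S -> S i j = S j i.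
Proof. by case=> _ _ [a [v Sav]]; rewrite !Sav mulrC dotC. Qed.

Lemma stratum_loop S i j : lorentz_stratum S -> idx i = None -> S i j = 0.
Proof. by case=> _ S0 _ i0; apply: S0; rewrite /split_pair i0. Qed.

(** Minkowski product of the normalised momentum [i] with the total momentum of the normalised
    representatives; [mass2] is the Minkowski square of that total. *)
Definition energy S i : R := \sum_mu `|S i (rep mu)|.
Definition mass2 S : R := \sum_mu energy S (rep mu).

Lemma energy_gt0 S i mu : lorentz_stratum S -> idx i = Some mu -> 0 < energy S i.
Proof.
move=> [sgS _ _] imu; have [nu munu] := other_index mu.
rewrite /energy (bigD1 nu) //=; apply: ltr_pwDl; last by apply: sumr_ge0.
rewrite normr_gt0 -sgr_eq0 sgS ?mulf_neq0 ?signr_eq0 //.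
by rewrite /split_pair imu idx_rep.
Qed.

Lemma mass2_gt0 S : lorentz_stratum S -> 0 < mass2 S.
Proof.
move=> SS; have eS mu := energy_gt0 SS (idx_rep mu).
rewrite /mass2 (bigD1 (Ordinal m_gt1)) //=; apply: ltr_pwDl => //.
by apply: sumr_ge0 => mu _; exact: ltW.
Qed.

Definition direction_gram S : 'M[R]_m := \matrix_(mu, nu)
  (1 - `|S (rep mu) (rep nu)| * mass2 S / (energy S (rep mu) * energy S (rep nu))).

Lemma gram_of_directions (G : 'M[R]_m) (x : 'I_m -> 'cV[R]_d) :
  (forall mu, G mu mu = 1) -> (forall mu nu, mu != nu -> G mu nu != 1) ->
  (forall mu nu, dot (x mu) (x nu) = G mu nu) ->
  exists c : sphere_configuration R d m, gram c = G.
Proof.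
move=> G1 GN1 xG; have [||c cx] := @conf_of_points R d m x.
- by move=> mu; rewrite xG.
- by move=> mu nu /GN1; rewrite xG.
by exists c; apply/matrixP => mu nu; rewrite mxE -xG -!cx.
Qed.

(* The rest frame of the total momentum of the representatives. *)
Lemma direction_gram_realized S : lorentz_stratum S ->
  exists c : sphere_configuration R d m, gram c = direction_gram S.
Proof.
move=> SS; have [sgS S0 [a [v Sav]]] := SS.
pose a' mu := sgn (rep mu) * a (rep mu).
pose v' mu := sgn (rep mu) *: v (rep mu).
have T mu nu : a' mu * a' nu - dot (v' mu) (v' nu) = `|S (rep mu) (rep nu)|.
  by rewrite normr_stratum // Sav !dot_lin /a'; to_field_ops R; ring.
pose u := \sum_mu a' mu; pose w := \sum_mu v' mu.
have bE mu : u * a' mu - dot w (v' mu) = energy S (rep mu).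
  rewrite mulr_suml dot_suml -sumrB; apply: eq_bigr => nu _.
  by rewrite T stratum_sym.
have qE : u ^+ 2 - dot w w = mass2 S.
  rewrite expr2 {1}/u mulr_suml {1}/w dot_suml -sumrB; apply: eq_bigr => mu _.
  by rewrite -bE mulrC dotC.
have eS mu := energy_gt0 SS (idx_rep mu).
have [|mu|x xE] := @boost_directions R d 'I_m a' v' u w.
- by rewrite qE mass2_gt0.
- by rewrite bE gt_eqF.
apply: (@gram_of_directions _ x).
- by move=> mu; rewrite mxE S0 ?split_pairxx // normr0 !mul0r subr0.
- move=> mu nu munu; rewrite mxE -subr_eq0 addrAC subrr sub0r oppr_eq0.
  rewrite !mulf_neq0 ?invr_eq0 ?mulf_neq0 ?gt_eqF ?mass2_gt0 //.
  rewrite normr_gt0 -sgr_eq0 sgS ?mulf_neq0 ?signr_eq0 //.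
  by rewrite /split_pair !idx_rep.
- by move=> mu nu; rewrite xE mxE !bE qE T.
Qed.

(** For [G] the Gram matrix of a configuration [x], this is the Minkowski Gram matrix of the vectors
    [sgn i * (1, x mu)], with the zero vector for loops. *)
Definition stratum_of_gram G : 'M[R]_n := \matrix_(i, j)
  (if (idx i, idx j) is (Some mu, Some nu) then sgn i * sgn j * (1 - G mu nu) else 0).

Lemma stratum_of_gramP (c : sphere_configuration R d m) :
  lorentz_stratum (stratum_of_gram (gram c)).
Proof.
split.
- move=> i j; rewrite /split_pair mxE; case: (idx i) => [mu|//]; case: (idx j) => [nu|//].
  move=> munu; rewrite !sgrM !sgr_sgn [X in _ * X]gtr0_sg ?mulr1 //.
  by rewrite subr_gt0 gram_offdiag.
- move=> i j; rewrite /split_pair mxE; case: (idx i) => [mu|//]; case: (idx j) => [nu|//].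
  by move=> /negPn/eqP ->; rewrite gram_diag subrr mulr0.
exists (fun i => if idx i is Some mu then sgn i else 0),
  (fun i => if idx i is Some mu then sgn i *: conf_point c mu else 0).
move=> i j; rewrite !mxE; case: (idx i) => [mu|]; last by rewrite mul0r dot0l subr0.
case: (idx j) => [nu|]; last by rewrite mulr0 dotC dot0l subr0.
by rewrite !dot_lin gramE; to_field_ops R; ring.
Qed.

Lemma norm_stratum_of_gram (c : sphere_configuration R d m) mu nu :
  `|stratum_of_gram (gram c) (rep mu) (rep nu)| = 1 - gram c mu nu.
Proof.
rewrite (normr_stratum _ _ (stratum_of_gramP c)).
rewrite [stratum_of_gram _ _ _]mxE !idx_rep.
by rewrite mulrA mulrACA !sgn2 !mul1r.
Qed.

(* Over a part, the momenta are lightlike and pairwise orthogonal, hence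
   parallel. *)
Lemma stratum_parallel S i mu : lorentz_stratum S -> idx i = Some mu ->
  exists2 k, 0 < k & forall j, `|S (rep mu) j| = k * `|S i j|.
Proof.
move=> SS imu; have [_ S0 [a [v Sav]]] := SS.
have light k : a k ^+ 2 = dot (v k) (v k).
  by apply/eqP; rewrite -subr_eq0 expr2 -Sav S0 // split_pairxx.
(* A lightlike vector without time component is zero, which would contradict positive energy. *)
have a_neq0 k nu : idx k = Some nu -> a k != 0.
  move=> knu; apply/eqP => ak0; have := energy_gt0 SS knu.
  have v0 : v k = 0 by apply/eqP; rewrite -dot_eq0 -light ak0 expr0n.
  rewrite /energy big1 ?ltxx // => ka _.
  by rewrite Sav ak0 v0 dot0l mul0r subr0 normr0.
have par : a i *: v (rep mu) = a (rep mu) *: v i.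
  apply: lightlike_parallel => //; apply/eqP; rewrite -subr_eq0 -Sav S0 //.
  by rewrite /split_pair imu idx_rep eqxx.
have ai := a_neq0 _ _ imu; have ar := a_neq0 _ _ (idx_rep mu).
(* The ratio of time components is the factor between the two parallel momenta, up to sign. *)
exists (`|a (rep mu)| / `|a i|) => [|j]; first by rewrite divr_gt0 ?normr_gt0.
apply: (mulfI (x := `|a i|)); first by rewrite normr_eq0.
rewrite mulrA [X in _ = X * _]mulrC divfK ?normr_eq0 // -!normrM.
rewrite !Sav; congr `|_|; rewrite !mulrBr.
by rewrite -dotZl par dotZl; to_field_ops R; ring.
Qed.

(** Each momentum is rescaled by a factor interpolating between [1 / energy] and 1, and the whole
    matrix by one interpolating between [mass2] and 1. For a loop the energy is 0 and its inverse is
    0 by convention, but there the entries of [S] vanish. *)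
Definition stratum_homotopy S (t : R) : 'M[R]_n := \matrix_(i, j)
  (S i j * ((1 - t) * mass2 S + t * 1)
    * ((1 - t) * (energy S i)^-1 + t * 1) * ((1 - t) * (energy S j)^-1 + t * 1)).

(** By [stratum_parallel], replacing [i] and [j] by their representatives multiplies the entry and
    the energies by the same factors, which cancel. *)
Lemma stratum_homotopy0 S : lorentz_stratum S ->
  stratum_homotopy S 0 = stratum_of_gram (direction_gram S).
Proof.
move=> SS; apply/matrixP => i j; rewrite [LHS]mxE [RHS]mxE.
rewrite !mul0r subr0 !mul1r !addr0.
case Ei: (idx i) => [mu|]; last by rewrite stratum_loop // !mul0r.
case Ej: (idx j) => [nu|]; last by rewrite stratum_sym // stratum_loop // !mul0r.
have [k k0 kE] := stratum_parallel SS Ei.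
have [l l0 lE] := stratum_parallel SS Ej.
have ek : energy S (rep mu) = k * energy S i.
  by rewrite /energy mulr_sumr; apply: eq_bigr => ka _; rewrite kE.
have el : energy S (rep nu) = l * energy S j.
  by rewrite /energy mulr_sumr; apply: eq_bigr => ka _; rewrite lE.
rewrite mxE subKr kE ek el (stratum_sym _ (rep nu)) // lE (stratum_sym _ i) //.
rewrite {1}stratumE //.
have /lt0r_neq0/eqP ei := energy_gt0 SS Ei.
have /lt0r_neq0/eqP ej := energy_gt0 SS Ej.
have /lt0r_neq0/eqP {}k0 := k0; have /lt0r_neq0/eqP {}l0 := l0.
by to_field_ops R; field; split; [|split; [|split]].
Qed.

Lemma stratum_homotopy1 S : stratum_homotopy S 1 = S.
Proof.
by apply/matrixP => i j; rewrite mxE subrr !mul0r !add0r !mul1r !mulr1.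
Qed.

Lemma convex_gt0 (t x y : R) : 0 <= t <= 1 -> 0 < x -> 0 < y ->
  0 < (1 - t) * x + t * y.
Proof.
move=> /andP[t0 t1] x0 y0; have [->|tn] := eqVneq t 0.
  by rewrite subr0 mul1r mul0r addr0.
apply: ltr_wpDl; first by rewrite mulr_ge0 ?subr_ge0 ?(ltW x0).
by rewrite mulr_gt0 // lt_def tn.
Qed.

Lemma stratum_homotopyP S t : lorentz_stratum S -> 0 <= t <= 1 ->
  lorentz_stratum (stratum_homotopy S t).
Proof.
move=> SS t01; have [sgS S0 [a [v Sav]]] := SS.
set c := (1 - t) * mass2 S + t * 1.
have c0 : 0 < c by rewrite convex_gt0 ?mass2_gt0.
split.
- move=> i j ij; rewrite mxE !sgrM (sgS i j) //.
  move: ij; rewrite /split_pair; case Ei: (idx i) => [mu|//].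
  case Ej: (idx j) => [nu|//] _.
  have ei := energy_gt0 SS Ei; have ej := energy_gt0 SS Ej.
  have e0 k : 0 < energy S k -> 0 < (1 - t) * (energy S k)^-1 + t * 1.
    by move=> ek; rewrite convex_gt0 ?invr_gt0.
  by rewrite (gtr0_sg c0) (gtr0_sg (e0 _ ei)) (gtr0_sg (e0 _ ej)) !mulr1.
- by move=> i j ij; rewrite mxE S0 // !mul0r.
pose e i := Num.sqrt c * ((1 - t) * (energy S i)^-1 + t * 1).
exists (fun i => e i * a i), (fun i => e i *: v i) => i j.
rewrite mxE Sav !dot_lin -/c.
have : c = Num.sqrt c * Num.sqrt c by rewrite -expr2 sqr_sqrtr ?ltW.
rewrite /e; set s := Num.sqrt c => {1}->.
by to_field_ops R; ring.
Qed.

(** Product of [(1, x mu)] with the observer [(1 - t) P + t e], where [P] is the total momentum and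
    [e] the unit time vector. [gram_mass2] is the Minkowski square of this observer, expanded along
    [P] and [e]. *)
Definition gram_energy G (t : R) mu : R :=
  (1 - t) * (\sum_nu (1 - G mu nu)) + t * 1.

Definition gram_mass2 G (t : R) : R :=
  (1 - t) * (\sum_mu gram_energy G t mu) + t * ((1 - t) * m%:R + t * 1).

Definition gram_homotopy G (t : R) : 'M[R]_m := \matrix_(mu, nu)
  (1 - (1 - G mu nu) * gram_mass2 G t / (gram_energy G t mu * gram_energy G t nu)).

Lemma gram_homotopy0 (c : sphere_configuration R d m) :
  gram_homotopy (gram c) 0 = direction_gram (stratum_of_gram (gram c)).
Proof.
have eE mu : gram_energy (gram c) 0 mu = energy (stratum_of_gram (gram c)) (rep mu).
  rewrite /gram_energy subr0 mul1r mul0r addr0; apply: eq_bigr => nu _.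
  by rewrite norm_stratum_of_gram.
apply/matrixP => mu nu; rewrite [LHS]mxE [RHS]mxE !eE norm_stratum_of_gram.
congr (_ - _ * _ / _); rewrite /gram_mass2 subr0 mul1r mul0r addr0.
by apply: eq_bigr => ka _; rewrite eE.
Qed.

Lemma gram_homotopy1 G : gram_homotopy G 1 = G.
Proof.
apply/matrixP => mu nu.
rewrite mxE /gram_mass2 /gram_energy subrr !mul0r !add0r !mulr1 divr1.
by rewrite subKr.
Qed.

Lemma gram_energy_gt0 (c : sphere_configuration R d m) t mu : 0 <= t <= 1 ->
  0 < gram_energy (gram c) t mu.
Proof.
move=> t01; apply: convex_gt0 => //; have [nu munu] := other_index mu.
rewrite (bigD1 nu) //=; apply: ltr_pwDl; first by rewrite subr_gt0 gram_offdiag.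
apply: sumr_ge0 => ka _; rewrite subr_ge0.
by have [->|/(gram_offdiag c)/ltW//] := eqVneq mu ka; rewrite gram_diag.
Qed.

Lemma gram_mass2_gt0 (c : sphere_configuration R d m) t : 0 <= t <= 1 ->
  0 < gram_mass2 (gram c) t.
Proof.
move=> t01; apply: convex_gt0 => //; last first.
  by apply: convex_gt0 => //; rewrite ltr0n ltnW.
rewrite (bigD1 (Ordinal m_gt1)) //=; apply: ltr_pwDl; first exact: gram_energy_gt0.
by apply: sumr_ge0 => ka _; apply/ltW/gram_energy_gt0.
Qed.

(* The observer moves along the segment from the total momentum of the
   lightlike vectors [(1, x mu)] to the time axis. *)
Lemma gram_homotopy_realized (c : sphere_configuration R d m) t : 0 <= t <= 1 ->
  exists c' : sphere_configuration R d m, gram c' = gram_homotopy (gram c) t.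
Proof.
move=> t01.
(* Time and space components of the observer; the total momentum has time component [m]. *)
pose u := (1 - t) * m%:R + t * 1.
pose w := (1 - t) *: \sum_mu conf_point c mu.
have bE mu : u * 1 - dot w (conf_point c mu) = gram_energy (gram c) t mu.
  rewrite /gram_energy sumrB sumr_const card_ord /u /w !dot_lin dot_suml.
  have -> : \sum_nu gram c mu nu = \sum_nu dot (conf_point c nu) (conf_point c mu).
    by apply: eq_bigr => nu _; rewrite mxE dotC.
  by rewrite mulr1 mulrBr addrAC.
have qE : u ^+ 2 - dot w w = gram_mass2 (gram c) t.
  rewrite /gram_mass2 -/u.
  have -> : \sum_mu gram_energy (gram c) t mu =
      m%:R * u - dot w (\sum_mu conf_point c mu).
    rewrite dotC dot_suml mulrC mulr_natr -[X in X - _](_ : \sum_(mu < m) u = _).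
      by rewrite -sumrB; apply: eq_bigr => mu _; rewrite -bE mulr1 dotC.
    by rewrite sumr_const card_ord.
  have -> : dot w w = (1 - t) * dot w (\sum_mu conf_point c mu).
    by rewrite -dotZr.
  rewrite /u; set X := dot w _; set M := m%:R.
  by to_field_ops R; ring.
have [|mu|x xE] := @boost_directions R d 'I_m (fun=> 1) (conf_point c) u w.
- by rewrite qE gram_mass2_gt0.
- by rewrite bE gt_eqF // gram_energy_gt0.
have e0 mu := gram_energy_gt0 c mu t01.
apply: (@gram_of_directions _ x).
- by move=> mu; rewrite mxE gram_diag subrr !mul0r subr0.
- move=> mu nu munu; rewrite mxE -subr_eq0 addrAC subrr sub0r oppr_eq0.
  rewrite !mulf_neq0 ?invr_eq0 ?mulf_neq0 ?gt_eqF ?gram_mass2_gt0 ?gram_energy_gt0 //.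
  by rewrite subr_gt0 gram_offdiag.
- by move=> mu nu; rewrite xE mxE !bE qE mulr1 mxE.
Qed.

End Stratum.

Arguments lorentz_stratum R {n m} d idx sigma.

(** * Homotopy equivalence *)

Lemma unit_interval (R : realType) (t : set_type `[0, 1 : R]) :
  0 <= (set_val t : R) <= 1.
Proof. by have := set_valP t; rewrite /= in_itv. Qed.

Section Equivalence.
Variables (R : realType) (n m d : nat).
Variables (idx : 'I_n -> option 'I_m) (rep : 'I_m -> 'I_n).
Variable sigma : {ffun 'I_n -> bool}.
Hypothesis idx_rep : forall mu, idx (rep mu) = Some mu.
Hypothesis m_gt1 : (1 < m)%N.
Local Notation stratum := (lorentz_stratum R d idx sigma).
Local Notation orb := (orbit_configuration R d m).

Lemma energy_continuous (X : topologicalType) (F : X -> 'M[R]_n) i :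
  continuous F -> continuous (fun x => energy rep (F x) i).
Proof.
move=> cF; apply: continuous_sum => mu.
by apply: continuous_norm; exact: continuous_coord.
Qed.

Lemma mass2_continuous (X : topologicalType) (F : X -> 'M[R]_n) :
  continuous F -> continuous (fun x => mass2 rep (F x)).
Proof. by move=> cF; apply: continuous_sum => mu; exact: energy_continuous. Qed.

Lemma direction_gram_continuous (X : topologicalType) (F : X -> 'M[R]_n) :
  continuous F -> (forall x, stratum (F x)) ->
  continuous (fun x => direction_gram rep (F x)).
Proof.
move=> cF FS; apply: continuous_mx => mu nu.
have -> : (fun x => direction_gram rep (F x) mu nu) = fun x => 1 -
    `|F x (rep mu) (rep nu)| * mass2 rep (F x) *
      (energy rep (F x) (rep mu) * energy rep (F x) (rep nu))^-1.
  by apply/funext => x; rewrite mxE.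
have eF ka x : energy rep (F x) (rep ka) != 0.
  by rewrite gt_eqF // (energy_gt0 idx_rep m_gt1 (FS x) (idx_rep ka)).
apply: continuous_sub; first exact: continuous_const.
apply: continuous_mul; first apply: continuous_mul.
- by apply: continuous_norm; exact: continuous_coord.
- exact: mass2_continuous.
apply: continuous_inv => [x|]; first by rewrite mulf_neq0.
by apply: continuous_mul; exact: energy_continuous.
Qed.

Lemma stratum_of_gram_continuous (X : topologicalType) (F : X -> 'M[R]_m) :
  continuous F -> continuous (fun x => stratum_of_gram idx sigma (F x)).
Proof.
move=> cF; apply: continuous_mx => i j.
case Ei: (idx i) => [mu|]; last first.
  have -> : (fun x => stratum_of_gram idx sigma (F x) i j) = fun=> 0.
    by apply/funext => x; rewrite mxE Ei.
  exact: continuous_const.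
case Ej: (idx j) => [nu|]; last first.
  have -> : (fun x => stratum_of_gram idx sigma (F x) i j) = fun=> 0.
    by apply/funext => x; rewrite mxE Ei Ej.
  exact: continuous_const.
have -> : (fun x => stratum_of_gram idx sigma (F x) i j) =
    fun x => sgn R sigma i * sgn R sigma j * (1 - F x mu nu).
  by apply/funext => x; rewrite mxE Ei Ej.
apply: continuous_mul; first exact: continuous_const.
apply: continuous_sub; first exact: continuous_const.
exact: continuous_coord.
Qed.

Lemma stratum_homotopy_continuous (X : topologicalType) (F : X -> 'M[R]_n)
    (t : X -> R) : continuous F -> continuous t -> (forall x, stratum (F x)) ->
  continuous (fun x => stratum_homotopy rep (F x) (t x)).
Proof.
move=> cF ct FS; apply: continuous_mx => i j.
(* For a loop the energy is 0, so [continuous_inv] does not apply, but the entry is identically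
   0. *)
case Ei: (idx i) => [mu|]; last first.
  have -> : (fun x => stratum_homotopy rep (F x) (t x) i j) = fun=> 0.
    by apply/funext => x; rewrite mxE (stratum_loop _ (FS x) Ei) !mul0r.
  exact: continuous_const.
case Ej: (idx j) => [nu|]; last first.
  have -> : (fun x => stratum_homotopy rep (F x) (t x) i j) = fun=> 0.
    apply/funext => x.
    by rewrite mxE (stratum_sym _ _ (FS x)) (stratum_loop _ (FS x) Ej) !mul0r.
  exact: continuous_const.
have -> : (fun x => stratum_homotopy rep (F x) (t x) i j) = fun x =>
    F x i j * ((1 - t x) * mass2 rep (F x) + t x * 1)
    * ((1 - t x) * (energy rep (F x) i)^-1 + t x * 1)
    * ((1 - t x) * (energy rep (F x) j)^-1 + t x * 1).
  by apply/funext => x; rewrite mxE.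
have ci k ka : idx k = Some ka -> continuous (fun x => (energy rep (F x) k)^-1).
  move=> kka; apply: continuous_inv => [x|]; last exact: energy_continuous.
  by rewrite gt_eqF // (energy_gt0 idx_rep m_gt1 (FS x) kka).
apply: continuous_mul; first apply: continuous_mul; first apply: continuous_mul.
- exact: continuous_coord.
- by apply: continuous_mix => //; [exact: mass2_continuous|exact: continuous_const].
- by apply: continuous_mix => //; [exact: ci Ei|exact: continuous_const].
- by apply: continuous_mix => //; [exact: ci Ej|exact: continuous_const].
Qed.

Lemma gram_homotopy_continuous (X : topologicalType) (F : X -> 'M[R]_m)
    (t : X -> R) : continuous F -> continuous t ->
  (forall x, exists c : sphere_configuration R d m, F x = gram c) ->
  (forall x, 0 <= t x <= 1) ->
  continuous (fun x => gram_homotopy (F x) (t x)).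
Proof.
move=> cF ct FG t01; apply: continuous_mx => mu nu.
have -> : (fun x => gram_homotopy (F x) (t x) mu nu) = fun x => 1 -
    (1 - F x mu nu) * gram_mass2 (F x) (t x) *
      (gram_energy (F x) (t x) mu * gram_energy (F x) (t x) nu)^-1.
  by apply/funext => x; rewrite mxE.
have c1 : continuous (fun _ : X => 1 : R) by exact: continuous_const.
have ce ka : continuous (fun x => gram_energy (F x) (t x) ka).
  apply: continuous_mix => //; apply: continuous_sum => la.
  by apply: continuous_sub => //; exact: continuous_coord.
have e0 ka x : gram_energy (F x) (t x) ka != 0.
  by have [c ->] := FG x; rewrite gt_eqF // gram_energy_gt0.
apply: continuous_sub => //; apply: continuous_mul; first apply: continuous_mul.
- by apply: continuous_sub => //; exact: continuous_coord.
- apply: continuous_mix => //; first exact: continuous_sum.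
  by apply: continuous_mix => //; exact: continuous_const.
apply: continuous_inv => [x|]; first by rewrite mulf_neq0.
exact: continuous_mul.
Qed.

Lemma stratum_orbit_equivalence :
  homotopy_equivalent R (set_type stratum) orb.
Proof.
have cval : continuous (set_val : set_type stratum -> 'M[R]_n).
  exact: initial_continuous.
have valS (S : set_type stratum) : stratum (set_val S) by exact: set_valP.
have ctime (X : topologicalType) :
    continuous (fun p : X * set_type `[0, 1 : R] => set_val p.2 : R).
  move=> p; apply: (@continuous_comp _ _ _ snd set_val); first exact: cvg_snd.
  exact: initial_continuous.
have cfst (X Y : topologicalType) : continuous (@fst X Y) by move=> p; exact: cvg_fst.
have [f cf fE] := orbit_realize (direction_gram_continuous cval valS)
  (fun S => direction_gram_realized idx_rep m_gt1 (valS S)).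
have gS (z : orb) : stratum_of_gram idx sigma (orbit_gram z) \in stratum.
  by apply/mem_set; exact: stratum_of_gramP.
pose g (z : orb) : set_type stratum := exist (fun S => S \in stratum) _ (gS z).
have cg : continuous g.
  apply: continuous_comp_initial.
  by apply: stratum_of_gram_continuous; exact: orbit_gram_continuous.
exists f, g; split=> //.
- have HS (p : set_type stratum * set_type `[0, 1 : R]) :
      stratum_homotopy rep (set_val p.1) (set_val p.2) \in stratum.
    by apply/mem_set; apply: stratum_homotopyP => //; exact: unit_interval.
  exists (fun p => exist (fun S => S \in stratum) _ (HS p)); split.
  + apply: continuous_comp_initial; apply: stratum_homotopy_continuous; last by [].
      move=> p; apply: (@continuous_comp _ _ _ fst set_val); first exact: cfst.
      exact: cval.
    exact: ctime.
  + move=> S t t0; apply: val_inj => /=; rewrite t0.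
    by rewrite (stratum_homotopy0 idx_rep m_gt1 (valS S)) fE.
  + by move=> S t t1; apply: val_inj => /=; rewrite t1 stratum_homotopy1.
(* This homotopy is built on Gram matrices and lifted by [orbit_realize]; its end maps are
   identified through [orbit_gram_inj]. *)
- pose F (p : orb * set_type `[0, 1 : R]) :=
    gram_homotopy (orbit_gram p.1) (set_val p.2).
  have cF : continuous F.
    apply: gram_homotopy_continuous.
    + move=> p; apply: (@continuous_comp _ _ _ fst (@orbit_gram R d m)).
        exact: cfst.
      exact: orbit_gram_continuous.
    + exact: ctime.
    + by move=> p; exists (repr p.1).
    + by move=> p; exact: unit_interval.
  have FG p : exists c : sphere_configuration R d m, gram c = F p.
    by apply: gram_homotopy_realized => //; exact: unit_interval.
  have [H cH HE] := orbit_realize cF FG; exists H; split=> //.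
  + move=> z t t0; apply: orbit_gram_inj; rewrite HE /F /= t0 fE.
    exact: gram_homotopy0.
  + by move=> z t t1; apply: orbit_gram_inj; rewrite HE /F /= t1 gram_homotopy1.
Qed.

End Equivalence.

(** Rank at most [d.+1] leaves at most [d] negative eigenvalues, which gives a realisation in [d]
    space dimensions. Conversely a realisation bounds the rank and forces the signature, as the sign
    conditions exclude [S = 0]. *)
Lemma enlarged_stratumE (R : realType) n m d (P : rank2_matroid n) sigma
    (idx : 'I_n -> option 'I_m) (rep : 'I_m -> 'I_n) :
  (forall mu, idx (rep mu) = Some mu) -> (1 < m)%N ->
  (forall i j, is_basis P i j = split_pair idx i j) ->
  enlarged_kinematic_stratum R P sigma d.+1 = lorentz_stratum R d idx sigma.
Proof.
move=> idx_rep m_gt1 PE; apply/seteqP; split=> S.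
  case=> r /= rd [[mS S0] sgS nS].
  have [a [v Sav]] : exists a (v : 'I_n -> 'cV[R]_d), lorentz_gram S a v.
    by apply: mandelstam_lorentz mS; case: r rd.
  split=> [i j|i j|]; last by exists a, v.
    by rewrite -PE => /sgS.
  by rewrite -PE; have [->|ij] := eqVneq i j; [rewrite S0|exact: nS].
move=> SS; have [sgS nS [a [v Sav]]] := SS.
have S0 i : S i i = 0 by apply: nS; exact: split_pairxx.
have [r rd mS] := lorentz_mandelstam0 Sav S0 (lorentz_stratum_neq0 idx_rep m_gt1 SS).
exists r => //; split=> // i j.
  by rewrite PE => /sgS.
by rewrite PE => _; exact: nS.
Qed.

Theorem theorem4p5 (R : realType) (n r m : nat) (hr : (3 <= r)%N)
    (P : rank2_matroid n) (sigma : {ffun 'I_n -> bool})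
    (hm : #|parts P| = m) :
  homotopy_equivalent R
    (set_type (enlarged_kinematic_stratum R P sigma r))
    (orbit_configuration R r.-1 m).
Proof.
(* Writing [r] as [d.+1] makes [d] the number of space dimensions. *)
case: r hr => // d _; case: m / hm => /=.
have [idx [rep [idx_rep PE]]] := matroid_index P.
have m_gt1 := parts_gt1 P.
rewrite (enlarged_stratumE R d sigma idx_rep m_gt1 PE).
exact: stratum_orbit_equivalence idx_rep m_gt1.
Qed.
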